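(* Let $n\in\mathbb N$, let $\delta$ be a positive infinitesimal and $\tau=\tau^\delta$. Then $(\mathcal G_0,\tau)$ is a Hausdorff topological ring.
   Context: Work in a sufficiently saturated nonstandard extension ${}^*$ of a superstructure over $\mathbb R$. $B_\delta=\{\xi\in{}^*\mathbb R^n:|\xi|\le\delta\}$. $\mathcal G_0$ is the ring of germs at $0\in\mathbb R^n$ of functions $f:(\mathbb R^n,0)\to(\mathbb R,0)$, with pointwise addition and multiplication. $\|{}^*f\|_\delta={}^*\sup\{|{}^*f(\xi)|:\xi\in B_\delta\}$; $\mathcal N_\delta=\{\|{}^*g\|_\delta:[g]\in\mathcal G_0\}$; for $\mathfrak r\in\mathcal N_\delta$, $\mathfrak r>0$, $U^\delta_{\mathfrak r}=\{[f]\in\mathcal G_0:\|{}^*f\|_\delta<\mathfrak r\}$. $\tau^\delta$ is the topology on $\mathcal G_0$ generated by all translates $[f]+U^\delta_{\mathfrak r}$, $[f]\in\mathcal G_0$.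
   Formalization: G_0 is taken to be the germs of functions f with f(0)=0 that are bounded near 0: for unbounded germs such as 1/x the *sup defining the norm does not exist in *R, and with value +∞ multiplication would fail to be continuous. *)

(* Defs.v *)
From HB Require Import structures.
From mathcomp Require Import all_boot all_order all_algebra generic_quotient.
From mathcomp Require Import ring_quotient.
From mathcomp Require Import all_classical all_reals all_analysis.

Set Implicit Arguments.
Unset Strict Implicit.
Unset Printing Implicit Defensive.

Import Order.TTheory GRing.Theory Num.Theory.
Import numFieldNormedType.Exports.

Local Open Scope classical_set_scope.
Local Open Scope quotient_scope.
Local Open Scope ring_scope.

(* [stage X k] is V_k(X), where V_0(X) = X and V_{k+1}(X) = X + P(V_k(X)):
   its elements are the atoms, [inl x], and the sets of elements of V_k(X),
   [inr A].  The superstructure V(X) is the union of the stages along the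
   inclusions [embed]. *)
Fixpoint stage (X : Type) (k : nat) : Type :=
  if k is k'.+1 then (X + set (stage X k'))%type else X.

Fixpoint embed (X : Type) (k : nat) : stage X k -> stage X k.+1 :=
  match k return stage X k -> stage X k.+1 with
  | 0 => fun x => inl x
  | k'.+1 => fun u =>
      match u with
      | inl x => inl x
      | inr A => inr (@embed X k' @` A)
      end
  end.

Definition atom (X : Type) (k : nat) : X -> stage X k :=
  match k return X -> stage X k with
  | 0 => fun x => x
  | k'.+1 => fun x => inl x
  end.

(* Membership in V(X), first between consecutive stages, then inside one. *)
Definition elt (X : Type) (k : nat) (u : stage X k) (v : stage X k.+1) : Prop :=
  match v with
  | inl _ => False
  | inr A => A u
  end.

Definition mem_stage (X : Type) (k : nat) : stage X k -> stage X k -> Prop :=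
  match k return stage X k -> stage X k -> Prop with
  | 0 => fun _ _ => False
  | k'.+1 => fun u v => exists2 z : stage X k', elt z v & u = embed z
  end.

(* Kuratowski pairs *)
Definition kpair (X : Type) (k : nat) (u v : stage X k) : stage X k.+2 :=
  inr [set inr [set u]; inr [set u; v]].

Inductive bformula : Type :=
| BMem of nat & nat
| BEq of nat & nat
| BNot of bformula
| BAnd of bformula & bformula
| BAll of nat & nat & bformula. (* [BAll i j p] is "forall x_i in x_j, p" *)

(* A formula has finitely many free variables, so that their values may be
   taken in a common stage. *)
Fixpoint bsat (X : Type) (k : nat) (e : nat -> stage X k) (p : bformula) : Prop :=
  match p with
  | BMem i j => mem_stage (e i) (e j)
  | BEq i j => e i = e j
  | BNot q => ~ bsat e q
  | BAnd q r => bsat e q /\ bsat e r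
  | BAll i j q => forall x : stage X k, mem_stage x (e j) ->
      bsat (fun m => if m == i then x else e m) q
  end.

(* A nonstandard extension * : V(X) -> V(Y), with *X = Y.  By transfer * maps
   V_k(X) to V_k(Y), so it is given stage by stage. *)
Record nonstandard_extension (X Y : Type) : Type := NonstandardExtension {
  star : forall k : nat, stage X k -> stage Y k;
  star_embed : forall (k : nat) (u : stage X k),
    star (embed u) = embed (star u);
  star_base : @star 1 (inr [set: X]) = inr [set: Y];
  star_transfer : forall (k : nat) (e : nat -> stage X k) (p : bformula),
    bsat e p <-> bsat (fun i => star (e i)) p;
  star_proper : exists y : Y, forall x : X, y <> @star 0 x
}.

Definition internal (X Y : Type) (E : nonstandard_extension X Y) (k : nat)
    (u : stage Y k) : Prop :=
  exists B : stage X k.+1, elt u (star E B).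

(* Saturation for families of internal sets indexed by [K], i.e.
   kappa-saturation where kappa is the successor of the cardinal of [K].  The
   sets of the family may be taken in one stage: intersect them with one of
   them. *)
Definition saturated (X Y : Type) (E : nonstandard_extension X Y) (K : Type) :
    Prop :=
  forall (k : nat) (A : K -> set (stage Y k)),
    (forall i : K, internal E (inr (A i) : stage Y k.+1)) ->
    (forall D : set K, finite_set D -> \bigcap_(i in D) A i !=set0) ->
    \bigcap_(i in [set: K]) A i !=set0.

(* A relation between [S] and [T], seen as an element of V(X) through codings
   [a] and [b] of the elements of [S] and [T]. *)
Definition rel_code (X S T : Type) (k : nat) (a : S -> stage X k)
    (b : T -> stage X k) (P : S -> T -> Prop) : stage X k.+3 :=
  inr [set w | exists s t, P s t /\ w = kpair (a s) (b t)].

Definition star_rel (X Y : Type) (E : nonstandard_extension X Y) (S T : Type)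
    (k : nat) (a : S -> stage X k) (b : T -> stage X k) (P : S -> T -> Prop)
    (u v : stage Y k) : Prop :=
  elt (kpair u v) (star E (rel_code a b P)).

Section germs.
Context {R : realType} {n : nat}.

(* The functions (R^n, 0) -> (R, 0) of which a germ is taken.  The condition of
   boundedness near 0 makes ||*f||_delta, a supremum in *R, exist. *)
Definition germ_fun_pred : {pred 'rV[R]_n -> R} :=
  [pred f | `[< f 0 = 0 /\
    exists M : R, \forall x \near (0 : 'rV[R]_n), `|f x| <= M >]].

Lemma germ_fun_zmod_closed : zmod_closed germ_fun_pred.
Proof.
split=> [|f g /asboolP[f0 [M fM]] /asboolP[g0 [N gN]]]; apply/asboolP.
  by split=> //; exists 0; near=> x; rewrite normr0.
split; first by rewrite !fctE f0 g0 subr0.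
exists (M + N); near=> x.
rewrite !fctE (le_trans (ler_normB _ _))// lerD//.
  by near: x.
by near: x.
Unshelve. all: by end_near. Qed.

HB.instance Definition _ := GRing.isZmodClosed.Build _ germ_fun_pred
  germ_fun_zmod_closed.

Record germ_fun : Type := GermFun {
  germ_fun_val :> 'rV[R]_n -> R;
  germ_funP : germ_fun_val \in germ_fun_pred }.

HB.instance Definition _ := [isSub for germ_fun_val].
HB.instance Definition _ := [Choice of germ_fun by <:].
HB.instance Definition _ := [SubChoice_isSubZmodule of germ_fun by <:].

Lemma germ_funBE (f g : germ_fun) x : (f - g) x = f x - g x.
Proof. by have /(congr1 (@^~ x)) := raddfB (val : germ_fun -> _) f g. Qed.

Lemma germ_fun_mul_subproof (f g : germ_fun) :
  (fun x => f x * g x) \in germ_fun_pred.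
Proof.
move: f g => [f /= /asboolP[f0 [M fM]]] [g /= /asboolP[g0 [N gN]]].
apply/asboolP; split; first by rewrite f0 mul0r.
exists (M * N); near=> x.
rewrite normrM ler_pM//; first by near: x.
by near: x.
Unshelve. all: by end_near. Qed.

Definition germ_fun_mul (f g : germ_fun) : germ_fun :=
  GermFun (germ_fun_mul_subproof f g).

(* Two functions have the same germ when their difference vanishes near 0. *)
Definition null_germ : {pred germ_fun} :=
  [pred f : germ_fun | `[< \forall x \near (0 : 'rV[R]_n), f x = 0 >]].

Lemma null_germ_zmod_closed : zmod_closed null_germ.
Proof.
split=> [|f g /asboolP f0 /asboolP g0]; apply/asboolP; near=> x => //.
rewrite germ_funBE.
have -> : f x = 0 by near: x.
have -> : g x = 0 by near: x.
by rewrite subr0.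
Unshelve. all: by end_near. Qed.

HB.instance Definition _ := GRing.isZmodClosed.Build _ null_germ
  null_germ_zmod_closed.

(* The ring G_0.  It has no unit: the constant 1 does not vanish at 0. *)
Definition germ : Type := {ideal_quot null_germ}.
HB.instance Definition _ := EqQuotient.on germ.
HB.instance Definition _ := GRing.Zmodule.on germ.

Definition germ_of (f : germ_fun) : germ := \pi_germ f.

Definition germ_mul (a b : germ) : germ :=
  germ_of (germ_fun_mul (repr a) (repr b)).

Lemma germ_ofP (f g : germ_fun) :
  germ_of f = germ_of g <-> \forall x \near (0 : 'rV[R]_n), f x = g x.
Proof.
split=> [/eqP|fg].
  rewrite /germ_of -Quotient.idealrBE => /asboolP fg.
  near=> x; apply/eqP; rewrite -subr_eq0 -germ_funBE; apply/eqP.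
  by near: x.
apply/eqP; rewrite /germ_of -Quotient.idealrBE; apply/asboolP; near=> x.
have fgx : f x = g x by near: x.
by rewrite germ_funBE fgx subrr.
Unshelve. all: by end_near. Qed.

Lemma germ_ofD : {morph germ_of : f g / f + g}.
Proof. exact: (Quotient.pi_add null_germ). Qed.

Lemma germ_ofM : {morph germ_of : f g / germ_fun_mul f g >-> germ_mul f g}.
Proof.
move=> f g; apply/germ_ofP.
have reprE (h : germ_fun) : \forall x \near (0 : 'rV[R]_n),
    (repr (germ_of h) : germ_fun) x = h x.
  by apply/germ_ofP; rewrite /germ_of reprK.
have := reprE f; have := reprE g.
move=> gE fE; near=> x => /=.
have -> : (repr (germ_of f) : germ_fun) x = f x by near: x.
by have -> : (repr (germ_of g) : germ_fun) x = g x by near: x.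
Unshelve. all: by end_near. Qed.

End germs.
Arguments germ_fun R n : clear implicits.
Arguments germ R n : clear implicits.

Definition enorm (R : realType) (n : nat) (x : 'rV[R]_n) : R :=
  Num.sqrt (\sum_(i < n) x ord0 i ^+ 2).

(* A vector x of R^n as an element of V(R): the function i |-> x_i, where the
   index i is the real number i. *)
Definition vec_code (R : realType) (n : nat) (x : 'rV[R]_n) : stage R 3 :=
  inr [set w | exists i : 'I_n, w = @kpair R 0 i%:R (x ord0 i)].

Section tau.
Context {R : realType} {Y : Type}.
Variable E : nonstandard_extension R Y.

(* [Y] plays the role of *R. *)
Definition star_lt (x y : Y) : Prop :=
  star_rel E (@atom R 0) (@atom R 0) (fun s t => s < t) x y.

Definition star_le (x y : Y) : Prop :=
  star_rel E (@atom R 0) (@atom R 0) (fun s t => s <= t) x y.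

Definition star_real (r : R) : Y := @star R Y E 0 r.

Definition positive_infinitesimal (d : Y) : Prop :=
  star_lt (star_real 0) d /\
  forall r : R, 0 < r -> star_lt d (star_real r).

(* [star_abs x y] reads y = *|x|. *)
Definition star_abs (x y : Y) : Prop :=
  star_rel E (@atom R 0) (@atom R 0) (fun s t => t = `|s|) x y.

(* [star_fun f xi y] reads y = *f(xi), for xi in *(R^n); the elements of
   *(R^n), like those of R^n, are in the third stage. *)
Definition star_fun (n : nat) (f : 'rV[R]_n -> R) (xi : stage Y 3) (y : Y) :
    Prop :=
  star_rel E (@vec_code R n) (@atom R 3) (fun x t => t = f x) xi (atom 3 y).

(* [star_sup A s] reads s = *sup A, for A an internal set of hyperreals. *)
Definition star_sup (A : set Y) (s : Y) : Prop :=
  star_rel E (fun B : set R => inr B : stage R 1) (@atom R 1)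
    (fun B t => has_sup B /\ t = sup B) (inr A) (atom 1 s).

Definition hyperball (n : nat) (d : Y) : set (stage Y 3) :=
  [set xi | exists2 r, star_fun (@enorm R n) xi r & star_le r d].

(* [delta_norm d f r] reads r = || *f ||_d. *)
Definition delta_norm (n : nat) (d : Y) (f : germ_fun R n) (r : Y) : Prop :=
  star_sup [set t | exists xi y,
    [/\ hyperball n d xi, star_fun f xi y & star_abs y t]] r.

Definition norm_values (n : nat) (d : Y) : set Y :=
  [set r | exists g : germ_fun R n, delta_norm d g r].

Definition germ_ball (n : nat) (d r : Y) : set (germ R n) :=
  [set a | exists f s, [/\ a = germ_of f, delta_norm d f s & star_lt s r]].

Definition germ_translates (n : nat) (d : Y) : set (set (germ R n)) :=
  [set A | exists a r, [/\ norm_values n d r, star_lt (star_real 0) r &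
    A = [set a + b | b in germ_ball d r]]].

End tau.

(* G_0 with the topology tau^d; [E] and [d] are there for the inference of the
   topology. *)
Definition germ_space (R : realType) (Y : Type)
  (E : nonstandard_extension R Y) (n : nat) (d : Y) : Type := germ R n.

HB.instance Definition _ (R : realType) (Y : Type)
    (E : nonstandard_extension R Y) (n : nat) (d : Y) :=
  GRing.Zmodule.on (germ_space E n d).
HB.instance Definition _ (R : realType) (Y : Type)
    (E : nonstandard_extension R Y) (n : nat) (d : Y) :=
  isSubBaseTopological.Build (germ_space E n d) (@germ_translates R Y E n d) id.

(* Rings are associative, not necessarily unital. *)
Record topological_ring (T : PreTopologicalZmodule.type) (mul : T -> T -> T) :
    Prop := TopologicalRing {
  topring_mulA : associative mul;
  topring_mulDl : left_distributive mul +%R;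
  topring_mulDr : right_distributive mul +%R;
  topring_add_continuous : continuous (fun x : T * T => x.1 + x.2);
  topring_opp_continuous : continuous (fun x : T => - x);
  topring_mul_continuous : continuous (fun x : T * T => mul x.1 x.2)
}.

(* Main.v *)
Require Import Defs.
From mathcomp Require Import all_boot all_order all_algebra.
From mathcomp Require Import all_classical all_reals all_analysis.
From mathcomp Require Import ring lra.

(* The sets A of reals with d in *A form a proper filter, finer than the
   right neighborhoods of 0.  By transfer, ||*f||_d < ||*g||_d holds exactly
   when sup_{|x| <= t} |f x| < sup_{|x| <= t} |g x| for t along this filter,
   so that the whole statement becomes one about real functions.

   A ball U_r need not contain a translate c + U_s for each c in it: r - ||c||
   may be smaller than every positive element of N_d.  Hence the neighborhoods
   have to be adapted to c.  For addition, (c/2 + U_{r/2}) + (c/2 + U_{r/2}) is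
   contained in c + U_r.  For multiplication, the intersection of c/L + U_{r/L}
   and -c/L + U_{r/L} is {u : sup (L|u| + |c|) < r}, which leaves room for the
   terms f v + g u + u v when L is large with respect to bounds on f and g.
   Finally a function whose germ is not 0 has a positive sup on each ball,
   which makes the topology Hausdorff. *)

Set Implicit Arguments.
Unset Strict Implicit.
Unset Printing Implicit Defensive.

Import Order.TTheory GRing.Theory Num.Theory.
Import numFieldNormedType.Exports.

Local Open Scope classical_set_scope.

(** * Satisfaction of bounded formulas in the stages *)

Section stages.
Context {X : Type}.

Lemma embed_inj k : injective (@embed X k).
Proof.
elim: k => [|k IH] /=; first by move=> u v [].
move=> [x|A] [y|B] //= [AB]; first by rewrite AB.
congr (inr _); apply/seteqP.
have sub (C D : set (stage X k)) : embed (k:=k) @` C = embed (k:=k) @` D ->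
    C `<=` D.
  move=> CD u Cu; have : (embed (k:=k) @` D) (embed u) by rewrite -CD; exists u.
  by case=> v Dv /IH <-.
by split; apply: sub.
Qed.

(** Parameters of a formula live in different stages; iterated embedding brings them to a common
    one. With [j] on the left, [stage X (j + k)] computes when [j] is a numeral. *)
Fixpoint embedn (j k : nat) : stage X k -> stage X (j + k) :=
  match j return stage X k -> stage X (j + k) with
  | 0 => id
  | j'.+1 => fun u => embed (embedn j' u)
  end.

Lemma embedn_inj j k : injective (@embedn j k).
Proof. by elim: j => [|j IH] u v //= /embed_inj /IH. Qed.

(** Embedding a set only re-embeds the elements it has. This is why a bounded formula keeps its
    meaning when its parameters are moved up. *)
Lemma mem_embed k (x : stage X k.+1) (w : stage X k) :
  mem_stage x (embed w) <-> exists2 z, mem_stage z w & x = embed z.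
Proof.
case: k w x => [|k] w x; first by split; case=> z [].
split.
  case=> z; case: w => [y|A] //= [a Aa <-] ->.
  by exists (embed a) => //; exists a.
case=> z [a]; case: w => [y|A] //= Aa -> ->.
by exists (embed a) => //; exists a.
Qed.

Lemma mem_embed2 k (x w : stage X k) :
  mem_stage (embed x) (embed w) <-> mem_stage x w.
Proof.
rewrite mem_embed; split=> [[z zw /embed_inj ->] //|xw].
by exists x.
Qed.

Lemma mem_embedn j k (x : stage X (j + k.+1)) (C : stage X k.+1) :
  mem_stage x (embedn j C) <-> exists2 z, elt z C & x = embedn j (embed z).
Proof.
elim: j x => [|j IH] x; first by [].
rewrite [embedn _ _]/= mem_embed; split.
  by case=> z /IH[y yC ->] ->; exists y.
by case=> y yC ->; exists (embedn j (embed y)) => //; apply/IH; exists y.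
Qed.

(** Kuratowski's condition phrased by membership inside one stage, as a bounded formula must express
    it, whereas [kpair] climbs two stages. *)
Definition is_pair k (p u v : stage X k) : Prop :=
  exists2 a, mem_stage a p & exists2 b, mem_stage b p &
  (forall w, mem_stage w a <-> w = u) /\
  (forall w, mem_stage w b <-> w = u \/ w = v) /\
  (forall w, mem_stage w p -> w = a \/ w = b).

Lemma is_pair_embed k (p u v : stage X k) :
  is_pair (embed p) (embed u) (embed v) <-> is_pair p u v.
Proof.
split.
  case=> a /mem_embed[a' ap ->] [b] /mem_embed[b' bp ->] [ha [hb hp]].
  exists a' => //; exists b' => //; split; [|split] => w.
  - rewrite -mem_embed2 ha; split=> [/embed_inj//|-> //].
  - rewrite -mem_embed2 hb.
    by split=> [[/embed_inj->|/embed_inj->]|[->|->]]; tauto.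
  - rewrite -mem_embed2 => /hp[/embed_inj->|/embed_inj->]; tauto.
case=> a ap [b bp [ha [hb hp]]].
exists (embed a); first exact/mem_embed2.
exists (embed b); first exact/mem_embed2.
split; [|split] => w.
- rewrite mem_embed; split=> [[z /ha -> //]|->]; exists u => //; exact/ha.
- rewrite mem_embed; split=> [[z /hb[] -> ->]|[]->]; [tauto|tauto| |].
    by exists u => //; apply/hb; left.
  by exists v => //; apply/hb; right.
- by rewrite mem_embed => -[z /hp[] -> ->]; tauto.
Qed.

Lemma is_pair_embedn j k (p u v : stage X k) :
  is_pair (embedn j p) (embedn j u) (embedn j v) <-> is_pair p u v.
Proof. by elim: j => [|j IH] //=; rewrite is_pair_embed. Qed.

Lemma mem_embed_elt k (x : stage X k.+1) (A : stage X k.+1) :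
  mem_stage x A <-> exists2 z, elt z A & x = embed z.
Proof. by []. Qed.

(** Extensionality fails for atoms, which have no elements; the element [z0] excludes them. *)
Lemma set_stage_ext k (A : stage X k.+1) (B : set (stage X k)) z0 :
  elt z0 A -> (forall z, elt z A <-> B z) -> A = inr B.
Proof.
case: A => [//|A _ AB]; congr (inr _); apply/seteqP; split=> z /AB //.
Qed.

Lemma is_pairE k (p : stage X k.+2) (u v : stage X k) :
  is_pair p (embed (embed u)) (embed (embed v)) <-> p = kpair u v.
Proof.
have memE (A : stage X k.+1) (z : stage X k) :
    mem_stage (embed (embed z)) (embed A) <-> elt z A.
  rewrite mem_embed2; split=> [[y yA /embed_inj ->] //|zA]; by exists z.
split.
  case=> a /mem_embed_elt[a' ap ->] [b] /mem_embed_elt[b' bp ->] [ha [hb hp]].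
  have a'E : a' = inr [set u].
    apply: (@set_stage_ext _ _ _ u); first exact/memE/ha.
    by move=> z; rewrite -memE ha; split=> [/embed_inj/embed_inj|->].
  have b'E : b' = inr [set u; v].
    apply: (@set_stage_ext _ _ _ u); first by apply/memE/hb; left.
    move=> z; rewrite -memE hb; split.
      by case=> /embed_inj/embed_inj ->; [left|right].
    by case=> ->; tauto.
  rewrite /kpair -a'E -b'E; apply: (@set_stage_ext _ _ _ a') => // z; split.
    move=> zp; have /hp : mem_stage (embed z) p by exists z.
    by case=> /embed_inj ->; [left|right].
  by case=> ->.
move=> ->.
pose sg : stage X k.+1 := inr [set u]; pose db : stage X k.+1 := inr [set u; v].
exists (embed sg); first by exists sg => //; left.
exists (embed db); first by exists db => //; right.
split; [|split] => w.
- rewrite mem_embed; split=> [[z [y /= -> ->] ->] //|->].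
  by exists (embed u) => //; exists u.
- rewrite mem_embed; split=> [[z [y /= [] -> ->] ->]|[]->]; [tauto|tauto| |].
    by exists (embed u) => //; exists u => //; left.
  by exists (embed v) => //; exists v => //; right.
- by case=> z [] -> ->; tauto.
Qed.

Lemma kpair_inj k (u v u' v' : stage X k) :
  kpair u v = kpair u' v' -> u = u' /\ v = v'.
Proof.
have inrE (A B : set (stage X k)) :
    (inr A : stage X k.+1) = inr B -> forall z, A z = B z.
  by case=> ->.
case=> /seteqP[AB BA].
have uu' : u = u'.
  have [/inrE/(_ u') S|/inrE/(_ u) S] := BA (inr [set u']) (or_introl erefl).
    by have : [set u] u' by rewrite -S.
  by have : [set u'] u by rewrite S; left.
split=> //; rewrite -{u'}uu' in AB BA *.
have vv' : v = u \/ v = v'.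
  have [/inrE/(_ v) S|/inrE/(_ v) S] := AB (inr [set u; v]) (or_intror erefl).
    by left; have : [set u] v by rewrite -S; right.
  by have : [set u; v'] v by rewrite -S; right.
have v'v : v' = u \/ v' = v.
  have [/inrE/(_ v') S|/inrE/(_ v') S] := BA (inr [set u; v']) (or_intror erefl).
    by left; have : [set u] v' by rewrite -S; right.
  by have : [set u; v] v' by rewrite -S; right.
by case: vv' v'v => [->|] // [->|].
Qed.

Definition upd k (e : nat -> stage X k) (i : nat) (x : stage X k) :=
  fun m => if m == i then x else e m.

(** Pairs a formula with its intended meaning, so that the meaning is computed along the syntax,
    once over [X] and once over [Y]. *)
Definition sem k (e : nat -> stage X k) (p : bformula) (P : Prop) : Prop :=
  bsat e p <-> P.

End stages.

(** * Derived connectives, and pairs and relations as bounded formulas *)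

Definition FImp p q := BNot (BAnd p (BNot q)).
Definition FOr p q := FImp (BNot p) q.
Definition FIff p q := BAnd (FImp p q) (FImp q p).
Definition FEx i j p := BNot (BAll i j (BNot p)).

(* Variables from 20 on are reserved for the bound variables of these two
   formulas. *)
Definition FPair p i j :=
  FEx 21 p (FEx 22 p (BAnd
    (BAnd (BMem i 21) (BAll 23 21 (BEq 23 i)))
    (BAnd (BAnd (BAnd (BMem i 22) (BMem j 22))
                (BAll 23 22 (FOr (BEq 23 i) (BEq 23 j))))
          (BAll 23 p (FOr (BEq 23 21) (BEq 23 22)))))).
Definition FRel c i j := FEx 20 c (FPair 20 i j).

Section semantics.
Context {X : Type}.

Lemma sem_not k (e : nat -> stage X k) p P : sem e p P -> sem e (BNot p) (~ P).
Proof. by rewrite /sem /= => ->. Qed.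

Lemma sem_and k (e : nat -> stage X k) p q P Q :
  sem e p P -> sem e q Q -> sem e (BAnd p q) (P /\ Q).
Proof. by rewrite /sem /= => -> ->. Qed.

Lemma sem_imp k (e : nat -> stage X k) p q P Q :
  sem e p P -> sem e q Q -> sem e (FImp p q) (P -> Q).
Proof.
rewrite /sem /= => -> ->; split=> [PQ HP|PQ [HP HQ]]; last exact/HQ/PQ.
by apply: contrapT => HQ; apply: PQ.
Qed.

Lemma sem_iff k (e : nat -> stage X k) p q P Q :
  sem e p P -> sem e q Q -> sem e (FIff p q) (P <-> Q).
Proof. by move=> hp hq; apply: sem_and; apply: sem_imp. Qed.

Lemma sem_all j k (C : stage X k.+1) (e : nat -> stage X (j + k.+1)) i c p G :
  e c = embedn j C ->
  (forall z, elt z C -> sem (upd e i (embedn j (embed z))) p (G z)) ->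
  sem e (BAll i c p) (forall z, elt z C -> G z).
Proof.
rewrite /sem /= => -> H; split=> [hx z zC|hz x /mem_embedn[z zC ->]].
  by apply/H => //; apply: hx; apply/mem_embedn; exists z.
exact/H/hz.
Qed.

Lemma sem_ex j k (C : stage X k.+1) (e : nat -> stage X (j + k.+1)) i c p G :
  e c = embedn j C ->
  (forall z, elt z C -> sem (upd e i (embedn j (embed z))) p (G z)) ->
  sem e (FEx i c p) (exists2 z, elt z C & G z).
Proof.
move=> ec H; have := sem_not (sem_all ec (fun z zC => sem_not (H z zC))).
rewrite /sem => ->; split=> [nH|[z zC Gz] /(_ z zC)//].
by apply: contrapT => h; apply: nH => z zC Gz; apply: h; exists z.
Qed.

Lemma sem_mem j k (C : stage X k.+1) (e : nat -> stage X (j + k.+1)) i c z :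
  e c = embedn j C -> e i = embedn j (embed z) -> sem e (BMem i c) (elt z C).
Proof.
rewrite /sem /= => -> ->; rewrite mem_embedn; split=> [[y yC]|zC]; last by exists z.
by move=> /embedn_inj/embed_inj ->.
Qed.

Lemma bsat_ex k (e : nat -> stage X k) i c p :
  bsat e (FEx i c p) <-> exists2 x, mem_stage x (e c) & bsat (upd e i x) p.
Proof.
split=> [/= nH|[x xc px] /= /(_ x xc)//].
by apply: contrapT => h; apply: nH => x xc px; apply: h; exists x.
Qed.

(** The bounds on the indices prevent capture by the bound variables 21, 22 and 23. *)
Lemma sem_pair k (e : nat -> stage X k) p i j :
  (p < 21)%N -> (i < 21)%N -> (j < 21)%N ->
  sem e (FPair p i j) (is_pair (e p) (e i) (e j)).
Proof.
move=> lp li lj; have ne m l : (m < 21)%N -> (20 < l)%N -> (m == l) = false.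
  by move=> ml ll; apply/ltn_eqF/(leq_trans ml).
have nes := (ne _ 21 lp isT, ne _ 22 lp isT, ne _ 23 lp isT,
  (ne _ 21 li isT, ne _ 22 li isT, ne _ 23 li isT),
  (ne _ 21 lj isT, ne _ 22 lj isT, ne _ 23 lj isT)).
rewrite /sem /FPair bsat_ex; split.
  case=> a ap /bsat_ex[b]; rewrite /upd !nes => bp /= [[]].
  rewrite !nes /= => ia ha [[[ib jb] hb] hp].
  exists a => //; exists b => //; split; [|split] => w.
  - by split=> [/ha|->].
  - split=> [/hb|[]-> //].
    by move=> h; apply: contrapT => h'; apply: h; tauto.
  - by move=> /hp h; apply: contrapT => h'; apply: h; tauto.
case=> a ap [b bp [ha [hb hp]]]; exists a => //; apply/bsat_ex; exists b.
  by rewrite /upd nes.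
rewrite /= /upd !nes /=; split; first by split=> [|w]; rewrite ?nes; [exact/ha|move/ha].
split; first (split; first by split; apply/hb; tauto).
  by move=> w /hb; tauto.
by move=> w /hp; tauto.
Qed.

Lemma sem_kpair j k (e : nat -> stage X (j + k.+3)) p i l
    (p0 : stage X k.+2) (u v : stage X k) :
  (p < 21)%N -> (i < 21)%N -> (l < 21)%N ->
  e p = embedn j (embed p0) ->
  e i = embedn j (embed (embed (embed u))) ->
  e l = embedn j (embed (embed (embed v))) ->
  sem e (FPair p i l) (p0 = kpair u v).
Proof.
move=> lp li ll ep ei el; have := sem_pair e lp li ll.
by rewrite /sem ep ei el is_pair_embedn is_pair_embed is_pairE.
Qed.

Lemma sem_rel j k (e : nat -> stage X (j + k.+3)) c i l
    (C : stage X k.+3) (u v : stage X k) :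
  (i < 20)%N -> (l < 20)%N ->
  e c = embedn j C ->
  e i = embedn j (embed (embed (embed u))) ->
  e l = embedn j (embed (embed (embed v))) ->
  sem e (FRel c i l) (elt (kpair u v) C).
Proof.
move=> li ll ec ei el.
have := @sem_ex j k.+2 C e 20 c (FPair 20 i l) (fun p => p = kpair u v) ec.
rewrite /sem => ->; first by split=> [[z zC <-//]|h]; exists (kpair u v).
by move=> z zC; apply: sem_kpair => //; rewrite ?(leqW li) ?(leqW ll) // /upd ltn_eqF.
Qed.

End semantics.

(** * The bounded sentences that are transferred, with their meanings *)

Section formulas.
Context {X : Type}.

Lemma sem_mem_stage j k (x C : stage X k) (e : nat -> stage X (j + k)) i c :
  e c = embedn j C -> e i = embedn j x -> sem e (BMem i c) (mem_stage x C).
Proof.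
rewrite /sem /= => -> ->.
by elim: j {e} => [//|j IH]; rewrite -IH; exact: mem_embed2.
Qed.

Definition Fdom := BAll 3 0 (FEx 4 1 (FEx 5 2 (FPair 3 4 5))).

Lemma sem_dom k (e : nat -> stage X k.+3) C A B :
  e 0 = C -> e 1 = embedn 2 A -> e 2 = embedn 2 B ->
  sem e Fdom (forall p, elt p C ->
    exists2 x, elt x A & exists2 y, elt y B & p = kpair x y).
Proof.
move=> e0 e1 e2.
apply: (@sem_all _ 0) => [//|p _]; apply: (@sem_ex _ 2) => [//|x _].
apply: (@sem_ex _ 2) => [//|y _]; exact: (@sem_kpair _ 0).
Qed.

Definition Fcap := BAll 4 0 (FImp (BMem 4 1) (BMem 4 2)).

Lemma sem_cap (e : nat -> stage X 1) A B C :
  e 0 = A -> e 1 = B -> e 2 = C ->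
  sem e Fcap (forall z, elt z A -> elt z B -> elt z C).
Proof.
move=> e0 e1 e2.
apply: (@sem_all _ 0) => [//|z _]; apply: sem_imp; exact: (@sem_mem _ 0).
Qed.

Definition Fempty := BAll 1 0 (BNot (BEq 1 1)).

Lemma sem_empty (e : nat -> stage X 1) A :
  e 0 = A -> sem e Fempty (forall z, elt z A -> False).
Proof.
move=> e0; apply: (@sem_all _ 0) => [//|z _].
by rewrite /sem /=; split=> [/(_ erefl)|].

Qed.

(** Variables 0 to 4 hold two relations giving values at t, the relation comparing these values, the
    set of t where the comparison holds, and the reals. *)
Definition Fcompare := BAll 5 4 (BAll 6 4 (BAll 7 4 (FImp (FRel 0 5 6)
  (FImp (FRel 1 5 7) (FIff (FRel 2 6 7) (BMem 5 3)))))).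

Lemma sem_compare (e : nat -> stage X 3) P Q L A S :
  e 0 = P -> e 1 = Q -> e 2 = L -> e 3 = embedn 2 A -> e 4 = embedn 2 S ->
  sem e Fcompare (forall t, elt t S -> forall s, elt s S -> forall r, elt r S ->
    elt (kpair t s) P -> elt (kpair t r) Q ->
    (elt (kpair s r) L <-> elt t A)).
Proof.
move=> e0 e1 e2 e3 e4.
apply: (@sem_all _ 2) => [//|t _]; apply: (@sem_all _ 2) => [//|s _].
apply: (@sem_all _ 2) => [//|r _].
apply: sem_imp; first exact: (@sem_rel _ 0 0).
apply: sem_imp; first exact: (@sem_rel _ 0 0).
apply: sem_iff; first exact: (@sem_rel _ 0 0).
exact: (@sem_mem _ 2).
Qed.

Definition Fsection i j := BAll 4 3 (FIff (FRel 0 i j) (BMem 4 2)).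

Lemma sem_sectionl (e : nat -> stage X 3) P c A S :
  e 0 = P -> e 1 = embedn 3 c -> e 2 = embedn 2 A -> e 3 = embedn 2 S ->
  sem e (Fsection 4 1)
    (forall t, elt t S -> (elt (kpair t c) P <-> elt t A)).
Proof.
move=> e0 e1 e2 e3.
apply: (@sem_all _ 2) => [//|t _].
apply: sem_iff; first exact: (@sem_rel _ 0 0).
exact: (@sem_mem _ 2).
Qed.

Lemma sem_sectionr (e : nat -> stage X 3) P c A S :
  e 0 = P -> e 1 = embedn 3 c -> e 2 = embedn 2 A -> e 3 = embedn 2 S ->
  sem e (Fsection 1 4)
    (forall t, elt t S -> (elt (kpair c t) P <-> elt t A)).
Proof.
move=> e0 e1 e2 e3.
apply: (@sem_all _ 2) => [//|t _].
apply: sem_iff; first exact: (@sem_rel _ 0 0).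
exact: (@sem_mem _ 2).
Qed.

Definition Fserial := BAll 3 1 (FEx 4 2 (FRel 0 3 4)).

Lemma sem_serial (e : nat -> stage X 3) P A S :
  e 0 = P -> e 1 = embedn 2 A -> e 2 = embedn 2 S ->
  sem e Fserial
    (forall t, elt t A -> exists2 s, elt s S & elt (kpair t s) P).
Proof.
move=> e0 e1 e2.
apply: (@sem_all _ 2) => [//|t _]; apply: (@sem_ex _ 2) => [//|s _].
exact: (@sem_rel _ 0 0).
Qed.

(* Variables 0 to 8 hold the parameters, in the order of [sem_norm]; 9 to 15
   are t, s, B, a, xi, y and r: s is the norm at t when it is the sup of some
   B whose elements are the |f xi| for |xi| = r <= t. *)
Definition Fnorm :=
  BAll 9 1 (BAll 10 1 (FIff (FRel 0 9 10) (FEx 11 2 (BAnd (BNot (BMem 11 1))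
    (BAnd (FRel 3 11 10) (BAll 12 1 (FIff (BMem 12 11)
      (FEx 13 4 (FEx 14 1 (BAnd
        (FEx 15 1 (BAnd (FRel 5 13 15) (FRel 6 15 9)))
        (BAnd (FRel 7 13 14) (FRel 8 14 12)))))))))))).

Definition in_values (S : stage X 1) (V : stage X 4) (Nm : stage X 6)
    (Le : stage X 3) (F : stage X 6) (Abs : stage X 3) (t a : stage X 0) : Prop :=
  exists2 xi, elt xi V & exists2 y, elt y S &
    (exists2 r, elt r S & elt (kpair xi (atom 3 r)) Nm /\ elt (kpair r t) Le) /\
    (elt (kpair xi (atom 3 y)) F /\ elt (kpair y a) Abs).

(** The clause [~ mem_stage B S] states that [B] is not an atom, in a form that transfers. Stage 6
    is where relations on coded vectors, themselves in stage 3, live. *)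
Lemma sem_norm (e : nat -> stage X 6) (Q : stage X 3) (S : stage X 1)
    (D : stage X 2) (Sup : stage X 4) (V : stage X 4) (Nm : stage X 6)
    (Le : stage X 3) (F : stage X 6) (Abs : stage X 3) :
  e 0 = embedn 3 Q -> e 1 = embedn 5 S -> e 2 = embedn 4 D -> e 3 = embedn 2 Sup ->
  e 4 = embedn 2 V -> e 5 = Nm -> e 6 = embedn 3 Le -> e 7 = F -> e 8 = embedn 3 Abs ->
  sem e Fnorm (forall t, elt t S -> forall s, elt s S ->
    (elt (kpair t s) Q <-> exists2 B, elt B D & ~ mem_stage B S /\
      (elt (kpair B (atom 1 s)) Sup /\ forall a, elt a S ->
        (elt a B <-> in_values S V Nm Le F Abs t a)))).
Proof.
move=> e0 e1 e2 e3 e4 e5 e6 e7 e8.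
apply: (@sem_all _ 5) => [//|t _]; apply: (@sem_all _ 5) => [//|s _].
apply: sem_iff; first exact: (@sem_rel _ 3 0).
apply: (@sem_ex _ 4) => [//|B _].
apply: sem_and; first by apply: sem_not; apply: (@sem_mem_stage 5).
apply: sem_and; first exact: (@sem_rel _ 2 1).
apply: (@sem_all _ 5) => [//|a _].
apply: sem_iff; first exact: (@sem_mem _ 5).
apply: (@sem_ex _ 2) => [//|xi _]; apply: (@sem_ex _ 5) => [//|y _].
apply: sem_and.
  apply: (@sem_ex _ 5) => [//|r _].
  apply: sem_and; first exact: (@sem_rel _ 0 3).
  exact: (@sem_rel _ 3 0).
apply: sem_and; first exact: (@sem_rel _ 0 3).
exact: (@sem_rel _ 3 0).
Qed.

End formulas.

(** * Transfer *)

Section extension.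
Context {X Y : Type} (E : nonstandard_extension X Y).

Lemma star_embedn j k (u : stage X k) : star E (embedn j u) = embedn j (star E u).
Proof. by elim: j => [//|j IH] /=; rewrite star_embed IH. Qed.

(** [P] and [Q] are the readings of the same formula before and after applying the extension to its
    parameters. *)
Lemma transfer k (e : nat -> stage X k) p P Q :
  sem e p P -> sem (fun i => star E (e i)) p Q -> P -> Q.
Proof. by rewrite /sem => <- <- /star_transfer. Qed.

Lemma rel_codeE S T k (a : S -> stage X k) (b : T -> stage X k) P s t :
  injective a -> injective b ->
  elt (kpair (a s) (b t)) (rel_code a b P) <-> P s t.
Proof.
move=> ai bi; split=> [|Pst]; last by exists s, t.
by case=> s' [t' [Pst /kpair_inj[/ai-> /bi->]]].
Qed.

(** Transfers the inclusion of a relation in the product of its coded domains. It recovers that a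
    point is in the extension of the coded vectors, or that a set of hyperreals is internal. *)
Lemma star_rel_dom S T k (a : S -> stage X k) (b : T -> stage X k) P u v :
  star_rel E a b P u v -> elt u (star E (inr (range a) : stage X k.+1)).
Proof.
move=> Puv; pose A : stage X k.+1 := inr (range a).
pose B : stage X k.+1 := inr (range b).
pose e i := match i with 0 => rel_code a b P | 1 => embedn 2 A | _ => embedn 2 B end.
have tr := transfer (@sem_dom _ _ e _ A B erefl erefl erefl)
  (@sem_dom _ _ (fun i => star E (e i)) _ _ _ erefl
    (star_embedn 2 A) (star_embedn 2 B)).
case: (tr _ _ Puv) => [p [s [t [_ ->]]]|x xA [y _ /kpair_inj[-> _]]] //.
by exists (a s); [exists s|exists (b t) => //; exists t].
Qed.

End extension.

(** * Extensions of sets and relations of reals, and of the norm on balls *)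

Section real_relations.
Context {R : realType} {Y : Type} (E : nonstandard_extension R Y).

Definition star_set (A : set R) (y : Y) : Prop :=
  @elt Y 0 y (star E (inr A : stage R 1)).

Definition star_rrel (P : R -> R -> Prop) (x y : Y) : Prop :=
  star_rel E (@atom R 0) (@atom R 0) P x y.

Let rcode (P : R -> R -> Prop) : stage R 3 :=
  rel_code (@atom R 0) (@atom R 0) P.

Let reals : stage R 1 := inr setT.

Let starT (y : Y) : @elt Y 0 y (star E reals).
Proof. by rewrite star_base. Qed.

Let rcodeE P s t : @elt R 2 (@kpair R 0 s t) (rcode P) <-> P s t.
Proof. by apply: rel_codeE => x y. Qed.

Lemma star_set_cap (A B C : set R) y :
  A `&` B `<=` C -> star_set A y -> star_set B y -> star_set C y.
Proof.
move=> ABC; pose e i : stage R 1 :=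
  match i with 0 => inr A | 1 => inr B | _ => inr C end.
have tr := transfer (@sem_cap _ e _ _ _ erefl erefl erefl)
  (@sem_cap _ (fun i => star E (e i)) _ _ _ erefl erefl erefl).
by refine (tr _ y) => z Az Bz; exact: ABC.
Qed.

Lemma star_set0 y : ~ star_set set0 y.
Proof.
pose e (i : nat) : stage R 1 := inr set0.
have tr := transfer (@sem_empty _ e _ erefl)
  (@sem_empty _ (fun i => star E (e i)) _ erefl).
by refine (tr _ y) => z.
Qed.

(** Turns a comparison of hyperreal values taken at [t] into membership of [t] in the extension of a
    real set; every inequality between norms is handled this way. *)
Lemma star_compare (P Q L : R -> R -> Prop) (A : set R) t s r :
  (forall t s r, P t s -> Q t r -> (L s r <-> A t)) ->
  star_rrel P t s -> star_rrel Q t r -> (star_rrel L s r <-> star_set A t).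
Proof.
move=> PQLA; pose e i : stage R 3 := match i with
  | 0 => rcode P | 1 => rcode Q | 2 => rcode L
  | 3 => embedn 2 (inr A : stage R 1) | _ => embedn 2 reals end.
have tr := transfer (@sem_compare _ e _ _ _ _ _ erefl erefl erefl erefl erefl)
  (@sem_compare _ (fun i => star E (e i)) _ _ _ _ _ erefl erefl erefl
    (star_embedn E 2 _) (star_embedn E 2 _)).
refine (tr _ t (starT t) s (starT s) r (starT r)) => t' _ s' _ r' _.
by rewrite !rcodeE; exact: PQLA.
Qed.

Lemma star_section (P : R -> R -> Prop) c t :
  star_rrel P t (star_real E c) <-> star_set [set x | P x c] t.
Proof.
pose e i : stage R 3 := match i with
  | 0 => rcode P | 1 => embedn 3 (c : stage R 0)
  | 2 => embedn 2 (inr [set x | P x c] : stage R 1) | _ => embedn 2 reals end.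
have tr := transfer (@sem_sectionl _ e _ _ _ _ erefl erefl erefl erefl)
  (@sem_sectionl _ (fun i => star E (e i)) _ _ _ _ erefl
    (star_embedn E 3 _) (star_embedn E 2 _) (star_embedn E 2 _)).
by refine (tr _ t (starT t)) => x _; exact: rcodeE.
Qed.

Lemma star_sectionr (P : R -> R -> Prop) c t :
  star_rrel P (star_real E c) t <-> star_set [set x | P c x] t.
Proof.
pose e i : stage R 3 := match i with
  | 0 => rcode P | 1 => embedn 3 (c : stage R 0)
  | 2 => embedn 2 (inr [set x | P c x] : stage R 1) | _ => embedn 2 reals end.
have tr := transfer (@sem_sectionr _ e _ _ _ _ erefl erefl erefl erefl)
  (@sem_sectionr _ (fun i => star E (e i)) _ _ _ _ erefl
    (star_embedn E 3 _) (star_embedn E 2 _) (star_embedn E 2 _)).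
by refine (tr _ t (starT t)) => x _; exact: rcodeE.
Qed.

Lemma star_serial (P : R -> R -> Prop) (A : set R) t :
  (forall t, A t -> exists s, P t s) -> star_set A t ->
  exists s, star_rrel P t s.
Proof.
move=> AP; pose e i : stage R 3 := match i with
  | 0 => rcode P | 1 => embedn 2 (inr A : stage R 1) | _ => embedn 2 reals end.
have tr := transfer (@sem_serial _ e _ _ _ erefl erefl erefl)
  (@sem_serial _ (fun i => star E (e i)) _ _ _ erefl
    (star_embedn E 2 _) (star_embedn E 2 _)).
move=> At; case: (tr _ t At) => [x /= /AP[s Pxs]|s _ Pts]; last by exists s.
by exists s => //; apply/rcodeE.
Qed.

Definition ball_values n (f : 'rV[R]_n -> R) (t : R) : set R :=
  [set a | exists2 x, enorm x <= t & a = `|f x|]%R.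

Definition is_ball_norm n (f : 'rV[R]_n -> R) (t s : R) : Prop :=
  has_sup (ball_values f t) /\ s = sup (ball_values f t).

(** Distinct indices have distinct codes because the naturals embed in the reals, so a code
    determines each coordinate. *)
Lemma vec_code_inj n : injective (@vec_code R n).
Proof.
have vecP (x y : 'rV[R]_n) : vec_code x = vec_code y ->
    forall i, x ord0 i = y ord0 i.
  case=> /seteqP[xy _] i.
  have [j /(@kpair_inj R 0)[ij ->]] :=
    xy (@kpair R 0 i%:R%R (x ord0 i)) (ex_intro _ i erefl).
  congr (y _ _); apply/val_inj/eqP.
  by rewrite -(@eqr_nat R); apply/eqP.
by move=> x y /vecP xy; apply/rowP.
Qed.

(** The bridge to real analysis: the hyperreal norm is the value at [d] of the extension of t |->
    sup of |f| on the ball of radius t. It is the transfer of [Fnorm], with both sides of the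
    sentence then decoded. *)
Lemma delta_normE n (d : Y) (f : germ_fun R n) s :
  delta_norm E d f s <-> star_rrel (is_ball_norm f) d s.
Proof.
pose Sup : stage R 4 := rel_code (fun B : set R => inr B : stage R 1)
  (@atom R 1) (fun B t => has_sup B /\ t = sup B).
pose D : stage R 2 := inr (range (fun B : set R => inr B : stage R 1)).
pose V : stage R 4 := inr (range (@vec_code R n)).
pose frel (g : 'rV[R]_n -> R) : stage R 6 :=
  rel_code (@vec_code R n) (@atom R 3) (fun x t => t = g x).
pose e i : stage R 6 := match i with
  | 0 => embedn 3 (rcode (is_ball_norm f))
  | 1 => embedn 5 reals | 2 => embedn 4 D | 3 => embedn 2 Sup
  | 4 => embedn 2 V | 5 => frel (@enorm R n)
  | 6 => embedn 3 (rcode (fun s t => s <= t)%R) | 7 => frel f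
  | _ => embedn 3 (rcode (fun s t => t = `|s|)%R) end.
have tr := transfer
  (@sem_norm _ e _ _ _ _ _ _ _ _ _ erefl erefl erefl erefl erefl erefl erefl
    erefl erefl)
  (@sem_norm _ (fun i => star E (e i)) _ _ _ _ _ _ _ _ _
    (star_embedn E 3 _) (star_embedn E 5 _) (star_embedn E 4 _)
    (star_embedn E 2 _) (star_embedn E 2 _) erefl (star_embedn E 3 _) erefl
    (star_embedn E 3 _)).
have atom_inj k : injective (@atom R k) by case: k => [|k] x y //= [].
have frelE g x t : elt (kpair (vec_code x) (atom 3 t)) (frel g) <-> t = g x.
  by apply: rel_codeE; [exact: vec_code_inj|exact: atom_inj].
have SupE B t : elt (kpair (inr B : stage R 1) (atom 1 t)) Sup <->
    has_sup B /\ t = sup B.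
  by apply: (@rel_codeE _ _ _ _ (fun B : set R => inr B : stage R 1));
     [move=> ? ? []|exact: atom_inj].
apply: iff_sym.
refine (iff_trans (tr _ d (starT d) s (starT s)) _) => {tr}.
  move=> t _ r _; rewrite rcodeE.
  (* Over the reals, the innermost clause of the sentence determines [B] as the set of values on the
     ball. *)
  have valE B : (forall a, elt a reals -> (elt a (inr B : stage R 1) <->
      @in_values R reals V (frel (@enorm R n)) (rcode (fun s t => s <= t)%R)
        (frel f) (rcode (fun s t => t = `|s|)%R) t a)) <-> B = ball_values f t.
    have inner a : @in_values R reals V (frel (@enorm R n))
        (rcode (fun s t => s <= t)%R) (frel f) (rcode (fun s t => t = `|s|)%R) t a
        <-> ball_values f t a.
      split.
        case=> _ [x _ <-] [y _ [[q _ [/frelE-> /rcodeE xt]]]].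
        by case=> /frelE -> /rcodeE ->; exists x.
      case=> x xt ->; exists (vec_code x); first by exists x.
      exists (f x) => //; split.
        exists (enorm x) => //; split; [exact/frelE|exact/rcodeE].
      split; [exact/frelE|exact/rcodeE].
    split=> [H|-> a _]; last by rewrite inner.
    apply/seteqP; split=> a; first by move/(H a I)/inner.
    by move/inner/(H a I).
  split=> [[hs ->]|[_ [B _ <-] [_ [/SupE[hs ->] /valE BE]]]].
    exists (inr (ball_values f t)); first by exists (ball_values f t).
    split; first by case.
    split; first exact/SupE.
    exact/valE.
  by rewrite BE in hs *.
apply: iff_sym.
(* Over the extension, the same clause determines the set whose supremum defines [delta_norm]. *)
pose T : set Y := [set t | exists xi y,
    [/\ hyperball E n d xi, star_fun E f xi y & star_abs E y t]].
have inner t : @in_values Y (star E reals) (star E V) (star E (frel (@enorm R n)))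
    (star E (rcode (fun s t => s <= t)%R)) (star E (frel f))
    (star E (rcode (fun s t => t = `|s|)%R)) d t <-> T t.
  split.
    case=> xi _ [y _ [[r _ [xr rd]] [fxy yt]]].
    by exists xi, y; split=> //; exists r.
  case=> xi [y [[r xr rd] fxy yt]]; exists xi; first exact: star_rel_dom xr.
  exists y => //; split=> //; by exists r.
split=> [Ts|].
  (* [T] is internal because it has a hyperreal supremum in the sense of [star_sup]. *)
  exists (inr T); first exact: star_rel_dom Ts.
  split; first by rewrite star_base; case.
  by split=> // a _; rewrite inner.
case=> -[y|B] BD [nB [BSup BE]].
  by case: nB; rewrite star_base; exists y.
suff BT : B = T by rewrite BT in BSup.
apply/seteqP; split=> a; first by move/(BE a (starT a))/inner.
by move/inner/(BE a (starT a)).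
Qed.

End real_relations.

(** * Norms on real balls, and the topology of germs *)

Local Open Scope ring_scope.

Section ball_norms.
Context {R : realType} {n : nat}.
Implicit Types (f g : 'rV[R]_n -> R) (t : R).

Lemma enorm0 : enorm (0 : 'rV[R]_n) = 0.
Proof.
by rewrite /enorm big1 ?sqrtr0// => i _; rewrite mxE expr0n.
Qed.

Lemma norm_le_enorm (x : 'rV[R]_n) : `|x| <= enorm x.
Proof.
rewrite [leLHS]mx_normrE; apply: bigmax_le => [|[i j] _]; first exact: sqrtr_ge0.
rewrite ord1 -sqrtr_sqr ler_wsqrtr// (bigD1 j)//= lerDl.
by apply: sumr_ge0 => k _; exact: sqr_ge0.
Qed.

Lemma enorm_le_norm (x : 'rV[R]_n) : enorm x <= n%:R * `|x|.
Proof.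
have x0 : 0 <= n%:R * `|x| by rewrite mulr_ge0.
rewrite -(ger0_norm x0) -sqrtr_sqr ler_wsqrtr//.
apply: (@le_trans _ _ (\sum_(i < n) `|x| ^+ 2)).
  apply: ler_sum => i _; rewrite -[leLHS]real_normK ?num_real// ler_sqr ?nnegrE//.
  rewrite [leRHS]mx_normrE; exact: (le_bigmax _ (fun ij => `|x ij.1 ij.2|) (ord0, i)).
rewrite sumr_const card_ord -[leLHS]mulr_natl exprMn ler_wpM2r ?sqr_ge0//.
case: (n) => [|m]; first by rewrite expr0n.
by rewrite expr2 ler_peMl// ler1n.
Qed.

(** The topology on vectors comes from the maximum norm, which is equivalent to the Euclidean one by
    the two preceding inequalities. *)
Lemma near0_enorm (P : 'rV[R]_n -> Prop) :
  (\forall x \near (0 : 'rV[R]_n), P x) <->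
  exists2 e, 0 < e & forall x, enorm x < e -> P x.
Proof.
split.
  move=> /nbhs_normP[e /= e0 He]; exists e => // x xe; apply: He => /=.
  by rewrite sub0r normrN (le_lt_trans (norm_le_enorm x)).
(* Dividing by n + 1 instead of n covers dimension 0. *)
case=> e e0 He; apply/nbhs_normP; exists (e / n.+1%:R) => /=.
  by rewrite divr_gt0.
move=> x /=; rewrite sub0r normrN ltr_pdivlMr// => xe; apply: He.
rewrite (le_lt_trans (enorm_le_norm x))// (le_lt_trans _ xe)// mulrC.
by rewrite ler_wpM2l// ler_nat.
Qed.

(** [sup] takes a default value on unbounded sets, hence the [has_sup] hypotheses below. *)
Definition ball_norm f t : R := sup (ball_values f t).

Lemma has_sup_ball_values f t M : 0 <= t ->
  (forall x, enorm x <= t -> `|f x| <= M) -> has_sup (ball_values f t).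
Proof.
move=> t0 fM; split; first by exists `|f 0|, 0; rewrite ?enorm0.
by exists M => _ [x xt ->]; exact: fM.
Qed.

Lemma ball_norm_ub f t x : has_sup (ball_values f t) -> enorm x <= t ->
  `|f x| <= ball_norm f t.
Proof. by move=> fs xt; apply: sup_upper_bound => //; exists x. Qed.

Lemma ball_norm_le f t M : has_sup (ball_values f t) ->
  (forall x, enorm x <= t -> `|f x| <= M) -> ball_norm f t <= M.
Proof. by move=> [f0 _] fM; apply: ge_sup => // _ [x xt ->]; exact: fM. Qed.

Lemma ball_normZ f t k : has_sup (ball_values f t) ->
  ball_norm (fun x => k * f x) t = `|k| * ball_norm f t.
Proof.
move=> fs; have kfs : has_sup (ball_values (fun x => k * f x) t).
  split; first by case: fs => -[_ [x xt _]] _; exists `|k * f x|, x.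
  exists (`|k| * ball_norm f t) => _ [x xt ->].
  by rewrite normrM ler_wpM2l// ball_norm_ub.
apply/eqP; rewrite eq_le; apply/andP; split.
  by apply: ball_norm_le => // x xt; rewrite normrM ler_wpM2l// ball_norm_ub.
(* The reverse inequality divides by |k|, so k = 0 is treated apart. *)
case: (eqVneq k 0) kfs => [->|k0] kfs.
  rewrite normr0 mul0r; case: fs => -[_ [x xt _]] _.
  exact: le_trans (normr_ge0 _) (ball_norm_ub kfs xt).
rewrite mulrC -ler_pdivlMr ?normr_gt0//; apply: ball_norm_le => // x xt.
by rewrite ler_pdivlMr ?normr_gt0// mulrC -normrM (ball_norm_ub kfs).
Qed.

Lemma eq_ball_norm f g t : (forall x, enorm x <= t -> f x = g x) ->
  ball_norm f t = ball_norm g t.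
Proof.
move=> fg; congr sup; apply/seteqP.
by split=> _ [x xt ->]; exists x; rewrite ?fg.
Qed.

End ball_norms.

(** * Algebra of representatives and ring laws for germs *)

Section germ_functions.
Context {R : realType} {n : nat}.

Lemma germ_scale_subproof (k : R) (f : germ_fun R n) :
  (fun x => k * f x) \in @germ_fun_pred R n.
Proof.
case: f => f /= /asboolP[f0 [M fM]]; apply/asboolP.
split; first by rewrite f0 mulr0.
exists (`|k| * M); near=> x; rewrite normrM ler_wpM2l//; near: x; exact: fM.
Unshelve. all: by end_near. Qed.

(** A radius must be the norm of some germ; scaling a representative makes the fractions of a radius
    available. *)
Definition germ_scale (k : R) (f : germ_fun R n) : germ_fun R n :=
  GermFun (germ_scale_subproof k f).

Lemma germ_funDE (f g : germ_fun R n) x : (f + g) x = f x + g x.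
Proof. by have /(congr1 (@^~ x)) := raddfD (val : germ_fun R n -> _) f g. Qed.

Lemma germ_funNE (f : germ_fun R n) x : (- f) x = - f x.
Proof. by have /(congr1 (@^~ x)) := raddfN (val : germ_fun R n -> _) f. Qed.

Lemma germ_funME (f g : germ_fun R n) x : germ_fun_mul f g x = f x * g x.
Proof. by []. Qed.

Lemma germ_funZE k (f : germ_fun R n) x : germ_scale k f x = k * f x.
Proof. by []. Qed.

Lemma germ_fun_ext (f g : germ_fun R n) : (forall x, f x = g x) -> f = g.
Proof. by move=> fg; apply/val_inj/funext. Qed.

Lemma germ_ofK (a : germ R n) : exists f : germ_fun R n, a = germ_of f.
Proof. by exists (repr a); rewrite /germ_of reprK. Qed.

Lemma germ_ofN : {morph @germ_of R n : f / - f}.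
Proof. exact: (Quotient.pi_opp (@null_germ R n)). Qed.

Lemma germ_ofB : {morph @germ_of R n : f g / f - g}.
Proof. by move=> f g; rewrite germ_ofD germ_ofN. Qed.

Lemma germ_fun_bounded (f : germ_fun R n) :
  exists2 M, 0 < M & exists2 e, 0 < e & forall x, enorm x < e -> `|f x| <= M.
Proof.
case: (f) => g /= /asboolP[_ [M /near0_enorm[e e0 gM]]].
exists (`|M| + 1); first by rewrite ltr_wpDl.
by exists e => // x /gM /le_trans; apply; rewrite ler_wpDr// ler_norm.
Qed.

Lemma germ_mulA : associative (@germ_mul R n).
Proof.
move=> a b c; have [[[f ->] [g ->]] [h ->]] := (germ_ofK a, germ_ofK b, germ_ofK c).
by rewrite -!germ_ofM; congr germ_of; apply: germ_fun_ext => x /=; rewrite mulrA.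
Qed.

Lemma germ_mulDl : left_distributive (@germ_mul R n) +%R.
Proof.
move=> a b c; have [[[f ->] [g ->]] [h ->]] := (germ_ofK a, germ_ofK b, germ_ofK c).
rewrite -germ_ofD -!germ_ofM -germ_ofD; congr germ_of; apply: germ_fun_ext => x.
by rewrite germ_funDE !germ_funME germ_funDE mulrDl.
Qed.

Lemma germ_mulDr : right_distributive (@germ_mul R n) +%R.
Proof.
move=> a b c; have [[[f ->] [g ->]] [h ->]] := (germ_ofK a, germ_ofK b, germ_ofK c).
rewrite -germ_ofD -!germ_ofM -germ_ofD; congr germ_of; apply: germ_fun_ext => x.
by rewrite germ_funDE !germ_funME germ_funDE mulrDr.
Qed.

End germ_functions.

(** * The filter of real sets whose extension contains [d], and norms along it *)

Section infinitesimal_filter.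
Context {R : realType} {Y : Type} (E : nonstandard_extension R Y) (n : nat).
Context (d : Y) (d_inf : positive_infinitesimal E d).
Implicit Types f g h k c u : germ_fun R n.

Definition hyper_nbhs : set_system R := fun A => star_set E A d.

#[local] Instance hyper_nbhs_filter : Filter hyper_nbhs.
Proof.
have pos_d : hyper_nbhs [set t | 0 < t].
  by have [/star_sectionr] := d_inf.
split; first exact: (star_set_cap _ pos_d pos_d).
  by move=> A B; exact: star_set_cap.
by move=> A B AB Ad; apply: (star_set_cap _ Ad Ad) => x [/AB].
Qed.

#[local] Instance hyper_nbhs_proper : ProperFilter hyper_nbhs.
Proof. split; [exact: star_set0|exact: hyper_nbhs_filter]. Qed.

Lemma hyper_gt0 : \forall t \near hyper_nbhs, 0 < t.
Proof. by have [/star_sectionr] := d_inf. Qed.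

Lemma hyper_lt e : 0 < e -> \forall t \near hyper_nbhs, t < e.
Proof. have [_ dlt] := d_inf; by move=> /dlt /star_section. Qed.

(** A representative is bounded on some ball of real radius, and [d] lies below that radius. *)
Lemma hyper_has_sup f : \forall t \near hyper_nbhs, has_sup (ball_values f t).
Proof.
have [M _ [e e0 fM]] := germ_fun_bounded f.
near=> t; apply: (@has_sup_ball_values _ _ _ _ M).
  by apply/ltW; near: t; exact: hyper_gt0.
move=> x xt; apply/fM/(le_lt_trans xt); near: t; exact: hyper_lt.
Unshelve. all: by end_near. Qed.

Lemma delta_norm_exists f : exists r, delta_norm E d f r.
Proof.
have [r fr] : exists r, star_rrel E (is_ball_norm f) d r.
  apply: (@star_serial _ _ _ _ [set t | has_sup (ball_values f t)]).
    by move=> t ft; exists (ball_norm f t).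
  exact: hyper_has_sup.
by exists r; apply/delta_normE.
Qed.

Lemma delta_norm_lt f g s r : delta_norm E d f s -> delta_norm E d g r ->
  star_lt E s r <-> \forall t \near hyper_nbhs, ball_norm f t < ball_norm g t.
Proof.
move=> /delta_normE fs /delta_normE gr.
apply: (star_compare (A := [set t | ball_norm f t < ball_norm g t]) _ fs gr).
by move=> t _ _ [_ ->] [_ ->].
Qed.

Lemma delta_norm_gt0 g r : delta_norm E d g r ->
  star_lt E (star_real E 0) r <-> \forall t \near hyper_nbhs, 0 < ball_norm g t.
Proof.
move=> /delta_normE gr.
(* Zero is compared as the value at [d] of a constant function. *)
apply: (star_compare (P := fun _ s => s = 0)
  (A := [set t | 0 < ball_norm g t]) _ _ gr); last first.
  apply/star_section.
  exact: (@filterS _ hyper_nbhs _ setT _ (fun _ _ => erefl) filterT).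
by move=> t _ _ -> [_ ->].
Qed.

(** Membership does not depend on the representative: two of them agree on a ball of real radius,
    hence on all balls of radius t along the filter. *)
Lemma germ_ballP f g r : delta_norm E d g r ->
  germ_ball E d r (germ_of f) <->
  \forall t \near hyper_nbhs, ball_norm f t < ball_norm g t.
Proof.
move=> gr; split; last first.
  by have [s fs] := delta_norm_exists f => /(delta_norm_lt fs gr) sr; exists f, s.
case=> f' [s [/germ_ofP/near0_enorm[e e0 ff'] f's /(delta_norm_lt f's gr) f'g]].
near=> t; rewrite (@eq_ball_norm _ _ _ f').
  by near: t.
move=> x xt; apply/ff'/(le_lt_trans xt); near: t; exact: hyper_lt.
Unshelve. all: by end_near. Qed.

(** * Neighborhoods and convergence in terms of translated balls *)

Definition translate (a : germ R n) (r : Y) : set (germ_space E n d) :=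
  [set a + b | b in germ_ball E d r].

Lemma translateP f h g r : delta_norm E d g r ->
  translate (germ_of f) r (germ_of h) <->
  \forall t \near hyper_nbhs, ball_norm (h - f) t < ball_norm g t.
Proof.
move=> gr; rewrite -(germ_ballP _ gr) germ_ofB; split=> [[b bb <-]|hf].
  by rewrite addrAC subrr add0r.
by exists (germ_of h - germ_of f); rewrite // addrC subrK.
Qed.

(** A nonempty translate has positive radius, since its radius exceeds the norm of a difference; it
    is then a subbasic open set. *)
Lemma translate_nbhs (a : germ R n) (z : germ_space E n d) g r :
  delta_norm E d g r -> translate a r z -> nbhs z (translate a r).
Proof.
move=> gr zr; have [f zE] := germ_ofK z; have [h aE] := germ_ofK a.
have rpos : star_lt E (star_real E 0) r.
  apply/(delta_norm_gt0 gr); move: zr; rewrite zE aE => /(translateP _ _ gr) zr.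
  near=> t; apply: (@le_lt_trans _ _ (ball_norm (f - h) t)); last by near: t.
  have ft : has_sup (ball_values (f - h) t) by near: t; exact: hyper_has_sup.
  by case: (ft) => -[_ [x xt _]] _; rewrite (le_trans _ (ball_norm_ub ft xt)).
rewrite nbhsE; exists (translate a r) => //; split=> //.
exists [set translate a r]; last exact: bigcup_set1.
move=> _ ->; apply: (@finI_from1 _ _ _ id); exists a, r; split=> //.
by exists g.
Unshelve. all: by end_near. Qed.

(** Convergence is tested on the subbase. The center [a] is arbitrary, because a translate
    containing [z] need not contain one centered at [z]. *)
Lemma cvg_translate (F : set_system (germ_space E n d)) (FF : Filter F)
    (z : germ_space E n d) :
  (forall a g r, delta_norm E d g r -> translate a r z -> F (translate a r)) ->
  F --> z.
Proof.
move=> Fz A; rewrite nbhsE => -[B [[D DF <-] [U DU Uz]] BA].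
apply: filterS BA _; have [D' D't UE] := DF U DU.
apply: (@filterS _ _ _ U); first by move=> x Ux; exists U.
rewrite -UE; apply: filter_bigI => A' A'D'.
have [a [r [[g gr] _ A'E]]] : germ_translates E d A' by exact/set_mem/D't.
have zA' : A' z by rewrite -UE in Uz; exact: Uz.
by rewrite A'E in zA' *; exact: Fz gr zA'.
Qed.

Lemma ball_norm_scale f (a : R) : \forall t \near hyper_nbhs,
  ball_norm (germ_scale a f) t = `|a| * ball_norm f t.
Proof. by near=> t; apply: ball_normZ; near: t; exact: hyper_has_sup.
Unshelve. all: by end_near. Qed.

Lemma ball_norm_triangle f g : \forall t \near hyper_nbhs,
  ball_norm (f + g) t <= ball_norm f t + ball_norm g t.
Proof.
near=> t; apply: ball_norm_le; first by near: t; exact: hyper_has_sup.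
move=> x xt; rewrite germ_funDE (le_trans (ler_normD _ _))// lerD//.
  by apply: ball_norm_ub => //; near: t; exact: hyper_has_sup.
by apply: ball_norm_ub => //; near: t; exact: hyper_has_sup.
Unshelve. all: by end_near. Qed.

Lemma ball_normN f t : ball_norm (- f) t = ball_norm f t.
Proof.
congr sup; apply/seteqP; split=> _ [x xt ->]; exists x => //;
by rewrite germ_funNE normrN.
Qed.

(** * Continuity of the ring operations *)

Local Notation G := (germ_space E n d).

Lemma germ_add_continuous : continuous (fun x : G * G => x.1 + x.2).
Proof.
case=> x0 y0; have [[f xE] [g yE]] := (germ_ofK x0, germ_ofK y0).
apply: cvg_translate => a k r kr.
have [h ->] := germ_ofK a.
rewrite xE yE -germ_ofD => /(translateP _ _ kr) clt.
pose c := f + g - h.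
have [r2 kr2] := delta_norm_exists (germ_scale 2^-1 k).
have cE u : u - (u - germ_scale 2^-1 c) = germ_scale 2^-1 c.
  by rewrite opprB addrC subrK.
have tr_half u : translate (germ_of (u - germ_scale 2^-1 c)) r2 (germ_of u).
  apply/(translateP _ _ kr2); rewrite cE; near=> t.
  have -> : ball_norm (germ_scale 2^-1 c) t = `|2^-1| * ball_norm c t.
    by near: t; exact: ball_norm_scale.
  have -> : ball_norm (germ_scale 2^-1 k) t = `|2^-1| * ball_norm k t.
    by near: t; exact: ball_norm_scale.
  by rewrite ltr_pM2l ?normr_gt0 ?invr_eq0//; near: t.
(* The two centers add up to [h], and [f] and [g] each lie at offset c/2 from theirs, within half
   the radius. *)
exists (translate (germ_of (f - germ_scale 2^-1 c)) r2,
        translate (germ_of (g - germ_scale 2^-1 c)) r2).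
  by split; apply: (translate_nbhs kr2); rewrite ?xE ?yE.
move=> [x y] /= [xf yg].
have [[p pE] [q qE]] := (germ_ofK x, germ_ofK y).
move: xf yg; rewrite pE qE -germ_ofD => /(translateP _ _ kr2) xf
  /(translateP _ _ kr2) yg; apply/(translateP _ _ kr).
have -> : p + q - h = (p - (f - germ_scale 2^-1 c)) + (q - (g - germ_scale 2^-1 c)).
  apply: germ_fun_ext => x'.
  rewrite !(germ_funBE, germ_funDE, germ_funZE).
  by move: (p x') (q x') (f x') (g x') (h x') => *; lra.
near=> t; apply: (@le_lt_trans _ _ (ball_norm (p - (f - germ_scale 2^-1 c)) t +
    ball_norm (q - (g - germ_scale 2^-1 c)) t)).
  by near: t; exact: ball_norm_triangle.
have -> : ball_norm k t =
    ball_norm (germ_scale 2^-1 k) t + ball_norm (germ_scale 2^-1 k) t.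
  have -> : ball_norm (germ_scale 2^-1 k) t = `|2^-1| * ball_norm k t.
    by near: t; exact: ball_norm_scale.
  by rewrite gtr0_norm ?invr_gt0//; lra.
by rewrite ltrD//; near: t.
Unshelve. all: by end_near. Qed.

Lemma germ_opp_continuous : continuous (fun x : G => - x).
Proof.
move=> x0; have [f xE] := germ_ofK x0.
have oppE u : - (germ_of u : G) = germ_of (- u) by exact/esym/germ_ofN.
(* Negation preserves norms, so the preimage of a translate is the translate of the same radius
   about the opposite center. *)
have oppP h k r u : delta_norm E d k r ->
    translate (germ_of h) r (germ_of (- u)) <->
    translate (germ_of (- h)) r (germ_of u).
  move=> kr; rewrite !(translateP _ _ kr).
  have -> : u - - h = - (- u - h) by rewrite opprB !opprK addrC.
  by split; apply: filterS => t; rewrite ball_normN.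
apply: (cvg_translate (fmap_filter _ (nbhs_filter (x0 : G)))) => a k r kr.
have [h ->] := germ_ofK a; rewrite xE oppE => /(oppP _ _ _ _ kr) tr.
apply: filterS (translate_nbhs kr tr) => x.
by have [u ->] := germ_ofK x; rewrite /= oppE => /(oppP _ _ _ _ kr).
Qed.

(** The bound is a real number independent of t, so it can enter the choice of the constant [L] for
    products. *)
Lemma hyper_bounded f : exists2 M, 0 < M & \forall t \near hyper_nbhs,
  forall x, enorm x <= t -> `|f x| <= M.
Proof.
have [M M0 [e e0 fM]] := germ_fun_bounded f; exists M => //.
near=> t => x xt; apply/fM/(le_lt_trans xt); near: t; exact: hyper_lt.
Unshelve. all: by end_near. Qed.

(** The intermediate bound [m] keeps the inequality of suprema strict without forming the supremum
    of the combined function. *)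
Definition damped_nbhs f c k (L : R) : set G :=
  [set x | exists2 h, x = germ_of h &
    \forall t \near hyper_nbhs, exists2 m, m < ball_norm k t &
      forall x, enorm x <= t -> L * `|h x - f x| + `|c x| <= m].

(** Since L|u| + |c| is the larger of |Lu + c| and |Lu - c|, this set contains the intersection of
    two translates of radius k/L, centered at f - c/L and f + c/L. *)
Lemma nbhs_damped f c k L : 0 < L ->
  (\forall t \near hyper_nbhs, ball_norm c t < ball_norm k t) ->
  nbhs (germ_of f : G) (damped_nbhs f c k L).
Proof.
move=> L0 ck; have L'0 : 0 < L^-1 by rewrite invr_gt0.
have scaleE g t : has_sup (ball_values g t) ->
    ball_norm (germ_scale L^-1 g) t = L^-1 * ball_norm g t.
  by move=> gt; rewrite ball_normZ// gtr0_norm.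
have [r kr] := delta_norm_exists (germ_scale L^-1 k).
pose c' := germ_scale L^-1 c.
have trf (s : germ_fun R n) : s = c' \/ s = - c' -> translate (germ_of (f - s)) r (germ_of f).
  move=> sc; apply/(translateP _ _ kr).
  have -> : f - (f - s) = s by rewrite opprB addrC subrK.
  near=> t; have -> : ball_norm s t = ball_norm c' t.
    by case: sc => ->; rewrite ?ball_normN.
  rewrite !scaleE ?ltr_pM2l//; first by near: t.
  - by near: t; exact: hyper_has_sup.
  - by near: t; exact: hyper_has_sup.
have Fnbhs : Filter (nbhs (germ_of f : G)) := nbhs_filter _.
have nb := @filterI _ _ Fnbhs _ _ (translate_nbhs kr (trf c' (or_introl erefl)))
  (translate_nbhs kr (trf (- c') (or_intror erefl))).
apply: (@filterS _ _ Fnbhs _ _ _ nb) => x.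
have [h ->] := germ_ofK x.
case=> /(translateP _ _ kr) h1 /(translateP _ _ kr) h2; exists h => //.
near=> t.
have sup1 : has_sup (ball_values (h - (f - c')) t).
  by near: t; exact: hyper_has_sup.
have sup2 : has_sup (ball_values (h - (f - - c')) t).
  by near: t; exact: hyper_has_sup.
have kL : ball_norm k t = L * ball_norm (germ_scale L^-1 k) t.
  rewrite scaleE ?mulrA ?divff ?mul1r ?gt_eqF//.
  by near: t; exact: hyper_has_sup.
exists (L * Num.max (ball_norm (h - (f - c')) t) (ball_norm (h - (f - - c')) t)).
  rewrite kL ltr_pM2l// gt_max; apply/andP; split; first by near: t.
  by near: t.
move=> y yt.
have := ball_norm_ub sup1 yt; have := ball_norm_ub sup2 yt.
rewrite !(germ_funBE, germ_funNE, germ_funZE).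
set A := ball_norm _ t; set B := ball_norm _ t => hA hB.
have -> : c y = L * (L^-1 * c y) by rewrite mulrA divff ?gt_eqF// mul1r.
rewrite normrM (gtr0_norm L0) -mulrDr ler_pM2l//.
set w := L^-1 * c y in hA hB *; set u := h y - f y.
have {}hA : `|u - w| <= A.
  by rewrite (_ : u - w = h y - (f y - - w))//; rewrite /u; ring.
have {}hB : `|u + w| <= B.
  by rewrite (_ : u + w = h y - (f y - w))//; rewrite /u; ring.
rewrite le_max; move: hA hB; rewrite !ler_norml => /andP[? ?] /andP[? ?].
(* |u| + |w| equals |u + w| when the signs agree and |u - w| when they differ. *)
have [w0|w0] := ger0P w; have [u0|u0] := ger0P u; apply/orP.
all: first [left; lra | right; lra].
Unshelve. all: by end_near. Qed.

Lemma germ_mul_continuous : continuous (fun x : G * G => germ_mul x.1 x.2 : G).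
Proof.
case=> x0 y0; have [[f xE] [g yE]] := (germ_ofK x0, germ_ofK y0).
apply: cvg_translate => a k r kr.
have [h ->] := germ_ofK a.
rewrite xE yE -germ_ofM => /(translateP _ _ kr) clt.
pose c := germ_fun_mul f g - h.
have [M1 M10 fM] := hyper_bounded f.
have [M2 M20 gM] := hyper_bounded g.
have [K K0 kK] := hyper_bounded k.
(* [M1], [M2] and [K] absorb the terms f v, g u and u v. The factor 2 compensates for averaging the
   two bounds, and the summand 1 gives L >= 2, from which |u| <= K follows. *)
pose L := 2 * (M1 + M2 + K + 1).
have L0 : 0 < L by rewrite /L; lra.
exists (damped_nbhs f c k L, damped_nbhs g c k L).
  by split; rewrite /= ?xE ?yE; exact: nbhs_damped.
move=> [x y] /= [[p -> px] [q -> qy]].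
rewrite -germ_ofM; apply/(translateP _ _ kr); near=> t.
have [m1 m1k pm] : exists2 m, m < ball_norm k t &
    forall x, enorm x <= t -> L * `|p x - f x| + `|c x| <= m by near: t.
have [m2 m2k qm] : exists2 m, m < ball_norm k t &
    forall x, enorm x <= t -> L * `|q x - g x| + `|c x| <= m by near: t.
have kt : has_sup (ball_values k t) by near: t; exact: hyper_has_sup.
have kKt : ball_norm k t <= K.
  by apply: ball_norm_le => //; near: t.
have fMt : forall x, enorm x <= t -> `|f x| <= M1 by near: t.
have gMt : forall x, enorm x <= t -> `|g x| <= M2 by near: t.
(* Each of the two damped bounds contains |c| once, so their average contains |c| exactly once. *)
apply: (@le_lt_trans _ _ ((m1 + m2) / 2)); last by lra.
apply: ball_norm_le; first by near: t; exact: hyper_has_sup.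
move=> z zt.
(* Expansion of (f + u)(g + v) - h with u = p - f and v = q - g. *)
have -> : (germ_fun_mul p q - h) z =
    c z + f z * (q z - g z) + (p z - f z) * g z + (p z - f z) * (q z - g z).
  by rewrite /c !germ_funBE !germ_funME; ring.
apply: (@le_trans _ _ (`|c z| + `|f z| * `|q z - g z| +
    `|p z - f z| * `|g z| + `|p z - f z| * `|q z - g z|)).
  rewrite -!normrM.
  by do 3 (apply: (le_trans (ler_normD _ _)); rewrite lerD2r).
move: (pm _ zt) (qm _ zt) (fMt _ zt) (gMt _ zt).
have := normr_ge0 (p z - f z); have := normr_ge0 (q z - g z).
have := normr_ge0 (c z).
move: `|p z - f z| `|q z - g z| `|c z| `|f z| `|g z| => u v w F F'.
move=> w0 v0 u0 pz qz fz gz.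
have uK : u <= K.
  have : 2 * u <= L * u by rewrite ler_wpM2r// /L; lra.
  by lra.
have Fv : F * v <= M1 * v by rewrite ler_wpM2r.
have uF : u * F' <= u * M2 by rewrite ler_wpM2l.
have uv : u * v <= K * v by rewrite ler_wpM2r.
have M1u : 0 <= M1 * u by rewrite mulr_ge0// ltW.
have Ku : 0 <= K * u by rewrite mulr_ge0// ltW.
have M2v : 0 <= M2 * v by rewrite mulr_ge0// ltW.
rewrite /L in pz qz; lra.
Unshelve. all: by end_near. Qed.

(** * Separation of distinct germs *)

Lemma germ_space_hausdorff : hausdorff_space G.
Proof.
move=> x y; have [[f ->] [g ->]] := (germ_ofK x, germ_ofK y) => xy.
apply: contrapT => fg.
(* Half the norm of f - g is the radius for which the balls about the two germs are disjoint. *)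
pose k := germ_scale 2^-1 (f - g); have [r kr] := delta_norm_exists k.
have kE t : has_sup (ball_values (f - g) t) ->
    ball_norm k t = 2^-1 * ball_norm (f - g) t.
  by move=> fgt; rewrite ball_normZ// gtr0_norm ?invr_gt0.
(* A supremum at most 0 on a ball of positive radius would make the two functions agree there, hence
   have the same germ. *)
have fg0 t : 0 < t -> has_sup (ball_values (f - g) t) -> 0 < ball_norm (f - g) t.
  move=> t0 fgt; rewrite ltNge; apply/negP => fgt0; apply: fg.
  apply/germ_ofP/near0_enorm; exists t => // z /ltW zt.
  apply/eqP; rewrite -subr_eq0 -germ_funBE -normr_le0.
  exact: le_trans (ball_norm_ub fgt zt) fgt0.
have self u : nbhs (germ_of u : G) (translate (germ_of u) r).
  apply: (translate_nbhs kr); apply/(translateP _ _ kr); near=> t.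
  have fgt : has_sup (ball_values (f - g) t) by near: t; exact: hyper_has_sup.
  apply: (@le_lt_trans _ _ 0); last first.
    by rewrite kE// mulr_gt0 ?invr_gt0// fg0//; near: t; exact: hyper_gt0.
  apply: ball_norm_le; first by near: t; exact: hyper_has_sup.
  by move=> z zt; rewrite germ_funBE subrr normr0.
have [z []] := xy _ _ (self f) (self g); have [h ->] := germ_ofK z.
move=> /(translateP _ _ kr) hf /(translateP _ _ kr) hg.
(* The filter is proper, so one real radius satisfies all the inequalities at once, against the
   triangle inequality. *)
have [t [[[[t1 t2] t3] t4] t5]] := filter_ex (filterI (filterI (filterI (filterI
  hf hg) (hyper_has_sup (f - g))) (ball_norm_triangle (h - g) (- (h - f))))
  hyper_gt0).
have fgE : h - g - (h - f) = f - g by rewrite opprB addrC addrA subrK.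
move: t4; rewrite fgE ball_normN; move: t1 t2; rewrite kE//; lra.
Unshelve. all: by end_near. Qed.

End infinitesimal_filter.

Theorem proposition10p8 (R : realType) (Y : Type)
    (E : nonstandard_extension R Y) (K : Type) (Esat : saturated E K)
    (n : nat) (d : Y) (d_inf : positive_infinitesimal E d) :
  topological_ring (T := germ_space E n d) germ_mul /\
  hausdorff_space (germ_space E n d).
Proof.
split; last exact: germ_space_hausdorff.
split.
- exact: germ_mulA.
- exact: germ_mulDl.
- exact: germ_mulDr.
- exact: germ_add_continuous.
- exact: germ_opp_continuous.
- exact: germ_mul_continuous.
Qed.
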